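(* Let $n\ge 3$. The group of contextual inversions $G_n$ is isomorphic to a semidirect product of $\mathbb{Z}_2$ and the abelian group $\mathbb{Z}_{12}^{n-1}$. Bases for this last abelian group are given by $$\{T^2_1,T^3_1,\dots,T^n_1\}\quad\text{or}\quad\{T^2_1,T^3_2,\dots,T^n_2\}.$$ The group of contextual inversions $\widetilde G_n$ is isomorphic to $\mathbb{Z}_2\ltimes\mathbb{Z}_{12}^{n-2}$ if $n$ is even and to $\mathbb{Z}_2\ltimes\mathbb{Z}_{12}^{n-1}$ if $n$ is odd. Bases for the abelian parts in these two cases are $$\{T^3_1,T^4_2,T^5_1,\dots,T^n_2\}\quad\text{if } n \text{ is even},$$ $$\{T^2_1,T^3_1,T^4_2,\dots,T^{n-1}_2,T^n_1\}\quad\text{if } n\text{ is odd}.$$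
   Context: $\mathbb{Z}_{12}=\mathbb{Z}/12\mathbb{Z}$. For $m\in\mathbb{Z}_{12}$ put $T_m(x)=x+m$ and $I_m(x)=-x+m$, acting componentwise on vectors $\langle x_1,\dots,x_n\rangle\in\mathbb{Z}_{12}^n$. For $i\neq j$, the contextual inversion $p_{ij}:\mathbb{Z}_{12}^n\to\mathbb{Z}_{12}^n$ is defined by $p_{ij}\langle x_1,\dots,x_n\rangle=I_{x_i+x_j}\langle x_1,\dots,x_n\rangle$ (so $p_{ij}=p_{ji}$). The operator $T^k_j:\mathbb{Z}_{12}^n\to\mathbb{Z}_{12}^n$ is defined by $T^k_j\langle x_1,\dots,x_n\rangle=T_{x_k-x_j}\langle x_1,\dots,x_n\rangle$. $G_n$ is the group of transformations of $\mathbb{Z}_{12}^n$ generated by all $p_{ij}$, $1\le i<j\le n$. $\widetilde G_n$ is the subgroup generated by $\{p_{12},p_{23},\dots,p_{n-1,n},p_{1n}\}$. A basis of an abelian group isomorphic to $\mathbb{Z}_{12}^r$ means a $\mathbb{Z}_{12}$-module basis. In the list for $n$ even, the operators are $T^k_1$ for odd $k$ and $T^k_2$ for even $k$, $3\le k\le n$; in the list for $n$ odd, they are $T^2_1$ together with $T^k_1$ for odd $k$ and $T^k_2$ for even $k$, $3\le k\le n$. *)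

(* Defs.v *)
From mathcomp Require Import all_boot all_order all_algebra all_fingroup all_solvable.
From mathcomp Require Import ring.

Set Implicit Arguments.
Unset Strict Implicit.
Unset Printing Implicit Defensive.

Import GRing.Theory.

Definition Tm (m a : 'Z_12) : 'Z_12 := (a + m)%R.
Definition Im (m a : 'Z_12) : 'Z_12 := (- a + m)%R.

Section Operators.
Variable n : nat.
Implicit Types (i j k : 'I_n) (x : 'rV['Z_12]_n).
Local Open Scope ring_scope.

Definition ctx_inv_fun i j x : 'rV['Z_12]_n := map_mx (Im (x 0 i + x 0 j)) x.

Definition ctx_transl_fun k j x : 'rV['Z_12]_n := map_mx (Tm (x 0 k - x 0 j)) x.

Lemma ctx_inv_fun_inj i j : injective (ctx_inv_fun i j).
Proof.
apply: inv_inj => x; apply/rowP => l; rewrite !mxE /Im.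
by move: (x 0 i) (x 0 j) (x 0 l) => a b c; ring.
Qed.

Lemma ctx_transl_fun_inj k j : injective (ctx_transl_fun k j).
Proof.
apply: (can_inj (g := ctx_transl_fun j k)) => x; apply/rowP => l.
rewrite !mxE /Tm.
by move: (x 0 k) (x 0 j) (x 0 l) => a b c; ring.
Qed.

Definition ctx_inv i j : {perm 'rV['Z_12]_n} := perm (@ctx_inv_fun_inj i j).

(* [ctx_transl k j] is the operator with upper index k and lower index j. *)
Definition ctx_transl k j : {perm 'rV['Z_12]_n} :=
  perm (@ctx_transl_fun_inj k j).

End Operators.

(* Elements of ['I_n] count from 0: the ordinal [i] stands for the index     *)
(* [i.+1] in {1, ..., n}, and [P] below relates 1-based indices, upper index *)
(* first.  The product of {perm _} is composition with the left factor       *)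
(* applied first; a generated subgroup is the same set of transformations    *)
(* with either order of composition.                                         *)
Definition ctx_inv_group (n : nat) : {group {perm 'rV['Z_12]_n}} :=
  <<[set ctx_inv e.1 e.2 | e : 'I_n * 'I_n & (e.1.+1 < e.2.+1)%N]>>%G.

Definition cyc_ctx_inv_group (n : nat) : {group {perm 'rV['Z_12]_n}} :=
  <<[set ctx_inv e.1 e.2 | e : 'I_n * 'I_n &
      ((e.2.+1 == e.1.+1 + 1) || (e.1.+1 == 1) && (e.2.+1 == n))%N]>>%G.

Definition ctx_transl_set (n : nat) (P : rel nat) :
    {set {perm 'rV['Z_12]_n}} :=
  [set ctx_transl e.1 e.2 | e : 'I_n * 'I_n & P e.1.+1 e.2.+1].

(* [A] is written multiplicatively, so the scalar a : 'Z_12 acts by          *)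
(* [x ^+ a], [a] being read as its representative in {0, ..., 11}; this is   *)
(* the module structure when [A] is abelian of exponent dividing 12.         *)
Definition Z12_basis (gT : finGroupType) (A B : {set gT}) : Prop :=
  [/\ B \subset A,
      forall a, a \in A ->
        exists c : gT -> 'Z_12, a = (\prod_(b in B) b ^+ c b)%g
    & forall c : gT -> 'Z_12, (\prod_(b in B) b ^+ c b)%g = 1%g ->
        {in B, forall b, c b = 0%R}].

(* [G] is the semidirect product of its normal subgroup [A], a copy of the   *)
(* additive group (Z/12)^r, and of some complement of order two.             *)
Definition Z2_sdprod_Z12 (gT : finGroupType) (G A : {group gT}) (r : nat) :
    Prop :=
  exists H : {group gT},
    [/\ (A ><| H)%g = G, H \isog [set: 'Z_2] & A \isog [set: 'rV['Z_12]_r]].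

(* Main.v *)
Require Import Defs.
From mathcomp Require Import all_boot all_order all_algebra all_fingroup all_solvable.
From mathcomp Require Import ring zify.

Set Implicit Arguments.
Unset Strict Implicit.
Unset Printing Implicit Defensive.

Import GRing.Theory.

(**
Call g a translation when it adds to every component of x the same amount
phi(x), where phi is unchanged when a constant is added to all components of x.
Under composition the amounts phi add up, so translations commute, and each
operator [T^k_j] is one, with phi(x) = x_k - x_j.  Since
[p_ij p_kl = T^i_k T^j_l] and conjugation by [p_ij] inverts every [T^k_l], the
translations in a group generated by some [p_ij] form a normal subgroup, for
which any [p_ij] of the group generates a complement of order two.  A family
[T^(k i)_(j i)] with [k] injective and [j i < k i] is free, because its matrix
is triangular; each of the listed bases is of this form.  Cyclically
consecutive inversions only yield the [T^(i+2)_i] and [T^1_(n-1)], [T^2_n]: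
these preserve the parity classes of indices when n is even and connect all
indices when n is odd.
*)

(** * Arithmetic of translations and contextual inversions *)

Section Translations.
Variable n : nat.
Local Notation V := 'rV['Z_12]_n.
Implicit Types (i j k l : 'I_n) (x : V) (g h : {perm V}) (phi psi : V -> 'Z_12).
Local Open Scope ring_scope.

Definition translates_by g phi : Prop :=
  (forall x, g x = x + const_mx (phi x)) /\
  (forall x a, phi (x + const_mx a) = phi x).

Lemma translates_by1 : translates_by 1%g (fun=> 0).
Proof.
by split=> // x; rewrite perm1; apply/rowP => l; rewrite !mxE addr0.
Qed.

Lemma translates_byM g h phi psi :
  translates_by g phi -> translates_by h psi ->
  translates_by (g * h)%g (fun x => phi x + psi x).
Proof.
move=> [gE phiE] [hE psiE]; split=> [x|x a]; last by rewrite phiE psiE.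
by rewrite permM hE gE psiE; apply/rowP => l; rewrite !mxE addrA.
Qed.

Lemma translates_byX g phi (a : 'Z_12) :
  translates_by g phi -> translates_by (g ^+ a)%g (fun x => a * phi x).
Proof.
(* The exponent in [g ^+ a] is the representative of [a]; writing the scalar as the image of that
   natural number lets one induction treat both. *)
move=> g_phi; rewrite -[X in fun x => X * _](natr_Zp a).
elim: (val a) => [|m [IH1 IH2]].
  have [t1 t2] := translates_by1.
  by rewrite expg0; split=> *; rewrite ?t1 ?mul0r.
have [t1 t2] := translates_byM g_phi (conj IH1 IH2); rewrite expgS.
split=> [x|x b]; last by rewrite g_phi.2.
by rewrite t1 -natr1 mulrDl mul1r addrC [in RHS]addrC [in phi x + _]addrC.
Qed.

Lemma translates_by_prod (I : Type) (r : seq I) (P : pred I)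
    (g : I -> {perm V}) (phi : I -> V -> 'Z_12) (c : I -> 'Z_12) :
  (forall e, P e -> translates_by (g e) (phi e)) ->
  translates_by (\prod_(e <- r | P e) g e ^+ c e)%g
                (fun x => \sum_(e <- r | P e) c e * phi e x).
Proof.
move=> g_phi; elim: r => [|e r [IH1 IH2]].
  have [t1 t2] := translates_by1.
  by split=> *; rewrite !big_nil // t1.
case Pe: (P e); last by split=> *; rewrite !big_cons Pe ?IH1 ?IH2.
have [t1 t2] :=
  translates_byM (translates_byX (c e) (g_phi e Pe)) (conj IH1 IH2).
by split=> [x|x a]; rewrite !big_cons Pe ?t1 ?t2.
Qed.

Lemma translates_by_inj g h phi psi :
  translates_by g phi -> translates_by h psi -> phi =1 psi -> g = h.
Proof. by move=> [gE _] [hE _] eq_phi; apply/permP=> x; rewrite gE hE eq_phi. Qed.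

Lemma translates_by_ctx_transl k j :
  translates_by (ctx_transl k j) (fun x => x 0 k - x 0 j).
Proof.
split=> [x|x a]; last by rewrite !mxE; ring.
by rewrite permE; apply/rowP => l; rewrite !mxE.
Qed.

Lemma ctx_translM i k l : (ctx_transl i k * ctx_transl k l)%g = ctx_transl i l.
Proof.
apply: translates_by_inj (translates_byM (translates_by_ctx_transl _ _)
  (translates_by_ctx_transl _ _)) (translates_by_ctx_transl _ _) _ => x /=.
by ring.
Qed.

Lemma ctx_transl_refl k : ctx_transl k k = 1%g.
Proof.
apply: translates_by_inj (translates_by_ctx_transl _ _) translates_by1 _ => x.
exact: subrr.
Qed.

Lemma ctx_transl_inv k l : ((ctx_transl k l)^-1)%g = ctx_transl l k.
Proof.
by apply/eqP; rewrite eq_invg_mul ctx_translM ctx_transl_refl.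
Qed.

Lemma ctx_invE i j x : ctx_inv i j x = - x + const_mx (x 0 i + x 0 j).
Proof. by rewrite permE; apply/rowP => l; rewrite !mxE. Qed.

Lemma ctx_invC i j : ctx_inv i j = ctx_inv j i.
Proof. by apply/permP => x; rewrite !ctx_invE [x 0 i + _]addrC. Qed.

Lemma ctx_invM i j k l :
  (ctx_inv i j * ctx_inv k l)%g = (ctx_transl i k * ctx_transl j l)%g.
Proof.
apply/permP => x.
have [-> _] := translates_byM (translates_by_ctx_transl i k)
  (translates_by_ctx_transl j l).
rewrite permM !ctx_invE; apply/rowP => m; rewrite !mxE; ring.
Qed.

Lemma ctx_invK i j : (ctx_inv i j * ctx_inv i j = 1)%g.
Proof. by rewrite ctx_invM !ctx_transl_refl mulg1. Qed.

Lemma ctx_invV i j : ((ctx_inv i j)^-1 = ctx_inv i j)%g.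
Proof. by apply/eqP; rewrite eq_invg_mul ctx_invK. Qed.

Lemma ctx_translJ k l i j :
  (ctx_transl k l ^ ctx_inv i j)%g = ctx_transl l k.
Proof.
rewrite conjgE ctx_invV; apply/permP => x.
rewrite !permM !ctx_invE; have [-> _] := translates_by_ctx_transl k l.
have [-> _] := translates_by_ctx_transl l k.
by apply/rowP => m; rewrite !mxE; ring.
Qed.

Lemma ctx_inv_not_translation i j phi :
  i != j -> ~ translates_by (ctx_inv i j) phi.
Proof.
move=> neq_ij [invE _]; have := invE (delta_mx 0 i); rewrite ctx_invE => /rowP E.
move: (E i) (E j); rewrite !mxE !eqxx /= ![j == i]eq_sym (negPf neq_ij) /=.
by rewrite add0r addr0 => E1 E2; move/eqP: E1; rewrite -E2.
Qed.

End Translations.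

(** * Triangular families: freeness, bases and semidirect products *)

Section TriangularFamily.
Variables (n r : nat) (k j : 'I_r -> 'I_n).
Hypotheses (k_inj : injective k) (lt_jk : forall i, j i < k i).
Local Notation V := 'rV['Z_12]_n.

Let t i := ctx_transl (k i) (j i).
Let B := [set t i | i : 'I_r].

Local Open Scope group_scope.

(** Among the [l] with [c l] nonzero, take the one with [k l] largest and evaluate at the unit
    vector of [k l]. Any other such [m] has [k m] different from [k l] and [j m < k m <= k l], so
    only [c l] survives. *)
Lemma triangular_free (c : 'I_r -> 'Z_12) :
  (forall x : V, (\sum_i c i * (x 0 (k i) - x 0 (j i)) = 0)%R) ->
  forall i, c i = 0%R.
Proof.
move=> c0 i; apply/eqP/negPn/negP => ci.
have [l cl lmax] := @arg_maxnP _ i (fun i => c i != 0%R) (fun i => val (k i)) ci.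
case/eqP: cl; rewrite -[RHS](c0 (delta_mx 0%R (k l))) (bigD1 l) //= big1 ?addr0.
  rewrite !mxE !eqxx /= -val_eqE /= (negPf (_ : _ != _)) ?subr0 ?mulr1 //.
  by rewrite neq_ltn lt_jk.
move=> m neq_ml; have [-> | cm] := eqVneq (c m) 0%R; first by rewrite mul0r.
rewrite !mxE /= (inj_eq k_inj) (negPf neq_ml) -val_eqE /=.
rewrite (negPf (_ : _ != _)) ?subrr ?mulr0 //.
by rewrite neq_ltn (leq_trans (lt_jk m) (lmax m cm)).
Qed.

(** A coincidence [t a = t b] would be a relation with coefficients 1 and -1. Injectivity allows
    products over the set [B] to be reindexed by ['I_r]. *)
Lemma ctx_transl_family_inj : injective t.
Proof.
move=> a b eq_t; apply/eqP/negPn/negP => neq_ab.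
pose c i : 'Z_12 := ((i == a)%:R - (i == b)%:R)%R.
suff /triangular_free/(_ a) : forall x : V,
    (\sum_i c i * (x 0 (k i) - x 0 (j i)) = 0)%R.
  by rewrite /c eqxx (negPf neq_ab).
move=> x.
have E (l : 'I_r) : (\sum_i (i == l)%:R * (x 0 (k i) - x 0 (j i)) =
                      x 0 (k l) - x 0 (j l))%R.
  rewrite (bigD1 l) //= eqxx mul1r big1 ?addr0 // => i /negPf->.
  by rewrite mul0r.
under eq_bigr do rewrite /c mulrBl.
rewrite sumrB !E; apply/eqP; rewrite subr_eq0; apply/eqP.
have [ta _] := translates_by_ctx_transl (k a) (j a).
have [tb _] := translates_by_ctx_transl (k b) (j b).
have := ta x; rewrite -[ctx_transl _ _]/(t a) eq_t tb => /addrI/rowP/(_ (k a)).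
by rewrite !mxE.
Qed.

(** Coordinate map that will be an isomorphism from the additive group of rows onto the group
    generated by [B]. *)
Definition family_comb (c : 'rV['Z_12]_r) := \prod_(i < r) t i ^+ c 0%R i.

Lemma translates_by_family_comb c :
  translates_by (family_comb c)
    (fun x => \sum_i c 0 i * (x 0 (k i) - x 0 (j i)))%R.
Proof. by apply: translates_by_prod => i _; apply: translates_by_ctx_transl. Qed.

Lemma family_combM : {in setT &, {morph family_comb : c d / c * d}}.
Proof.
move=> c d _ _.
apply: translates_by_inj (translates_by_family_comb _) (translates_byM
  (translates_by_family_comb c) (translates_by_family_comb d)) _ => x.
by rewrite -big_split /=; apply: eq_bigr => i _; rewrite mxE mulrDl.
Qed.

Canonical family_comb_morphism := Morphism family_combM.

Lemma family_comb_injm : 'injm family_comb_morphism.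
Proof.
apply/subsetP => c; rewrite !inE /= => /eqP c1; apply/eqP/rowP => i.
rewrite mxE; apply: (triangular_free (c := c 0%R)) => x.
have [E _] := translates_by_family_comb c.
move: (E x); rewrite c1 perm1 => /rowP/(_ (k i)).
by rewrite !mxE -[X in X = _]addr0 => /addrI.
Qed.

Lemma family_comb_delta i : family_comb (delta_mx 0%R i) = t i.
Proof.
apply: translates_by_inj (translates_by_family_comb _)
  (translates_by_ctx_transl _ _) _ => x.
rewrite (bigD1 i) //= big1 ?addr0 => [|m /negPf neq_mi].
  by rewrite mxE !eqxx mul1r.
by rewrite mxE neq_mi andbF mul0r.
Qed.

Lemma family_comb_im : family_comb_morphism @* setT = <<B>>.
Proof.
apply/eqP; rewrite eqEsubset gen_subG; apply/andP; split.
  apply/subsetP => _ /morphimP[c _ _ ->]; rewrite group_prod // => i _.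
  by rewrite groupX // mem_gen // imset_f.
apply/subsetP => _ /imsetP[i _ ->]; rewrite -family_comb_delta.
by rewrite (mem_morphim family_comb_morphism) ?inE.
Qed.

Lemma family_gen_isog : <<B>> \isog [set: 'rV['Z_12]_r].
Proof.
rewrite -family_comb_im isog_sym.
exact: sub_isog (subxx _) family_comb_injm.
Qed.

Lemma translates_by_family_prod (c : {perm V} -> 'Z_12) :
  translates_by (\prod_(b in B) b ^+ c b)
    (fun x => \sum_i c (t i) * (x 0 (k i) - x 0 (j i)))%R.
Proof.
(* Amounts must here depend on the permutation, not on its index. Summing over the fibre of [t]
   achieves this without an inverse of [t]; on [B] the fibre is a single index. *)
pose phi b (x : V) : 'Z_12 := (\sum_(i | t i == b) (x 0 (k i) - x 0 (j i)))%R.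
have phiE i x : phi (t i) x = (x 0 (k i) - x 0 (j i))%R.
  by apply: big_pred1 => l; rewrite (inj_eq ctx_transl_family_inj).
have /(translates_by_prod (index_enum _) c) [E1 E2] :
    forall b, b \in B -> translates_by b (phi b).
  move=> _ /imsetP[i _ ->].
  have [t1 t2] := translates_by_ctx_transl (k i) (j i).
  by split=> [x|x a]; rewrite !phiE ?t1 ?t2.
have E x : (\sum_(b in B) c b * phi b x =
            \sum_i c (t i) * (x 0 (k i) - x 0 (j i)))%R.
  rewrite big_imset /=; last by move=> a b _ _; apply: ctx_transl_family_inj.
  by apply: eq_bigr => i _; rewrite phiE.
by split=> [x|x a]; [rewrite -E E1 | rewrite -!E E2].
Qed.

Lemma family_Z12_basis : Z12_basis <<B>> B.
Proof.
split; first exact: subset_gen.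
  move=> a; rewrite -family_comb_im => /morphimP[c _ _ ->].
  (* Coordinates are carried from indices to permutations by inverting [t]; 0 is an arbitrary value
     off [B]. *)
  exists (fun b => if [pick i | t i == b] is Some i then c 0%R i else 0%R).
  apply: translates_by_inj (translates_by_family_comb c)
    (translates_by_family_prod _) _ => x.
  apply: eq_bigr => i _; case: pickP => [l|/(_ i)]; last by rewrite eqxx.
  by move=> /eqP/ctx_transl_family_inj->.
move=> c c1 _ /imsetP[i _ ->]; apply: (triangular_free (c := c \o t)) => x.
have [E _] := translates_by_family_prod c.
move: (E x); rewrite c1 perm1 => /rowP/(_ (k i)).
by rewrite !mxE -[X in X = _]addr0 => /addrI.
Qed.

Lemma family_gen_translates g :
  g \in <<B>> -> exists phi, translates_by g phi.
Proof.
rewrite -family_comb_im => /morphimP[c _ _ ->].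
exists (fun x => \sum_i c 0 i * (x 0 (k i) - x 0 (j i)))%R.
exact: translates_by_family_comb.
Qed.

(** The complement is generated by [p = ctx_inv i0 i1]: it normalizes [<<B>>] because conjugation by
    it inverts each [t i], and it lies outside because it is no translation. A generator times [p]
    is the product of translations that the last hypothesis puts in [<<B>>], so [<<B>>] and [p]
    generate [G]. *)
Lemma family_sdprod (E : pred ('I_n * 'I_n)) i0 i1 :
  let G := <<[set ctx_inv e.1 e.2 | e : 'I_n * 'I_n & E e]>>%G in
  i0 != i1 -> E (i0, i1) -> B \subset G ->
  (forall e, E e -> ctx_transl e.1 i0 * ctx_transl e.2 i1 \in <<B>>) ->
  Z2_sdprod_Z12 G <<B>>%G r.
Proof.
move=> G neq_i E01 sBG sGA; set p := ctx_inv i0 i1.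
have p2 : #[p] = 2.
  apply/prime_nt_dvdP => //; last by rewrite order_dvdn expgS expg1 ctx_invK.
  rewrite order_eq1; apply/eqP => p1.
  apply: (ctx_inv_not_translation neq_i (phi := fun=> 0%R)).
  by rewrite -/p p1; apply: translates_by1.
have nBp : <[p]> \subset 'N(<<B>>).
  rewrite cycle_subG inE -genJ gen_subG; apply/subsetP => _ /imsetP[b Bb ->].
  case/imsetP: Bb => i _ ->; rewrite ctx_translJ -ctx_transl_inv groupV -/(t i).
  by rewrite mem_gen // imset_f.
have Gp : p \in G.
  by rewrite mem_gen //; apply/imsetP; exists (i0, i1); rewrite ?inE.
exists <[p]>%G; split; last exact: family_gen_isog.
  rewrite sdprodE // => [|]; last first.
    rewrite setIC prime_TIg -?orderE ?p2 // cycle_subG.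
    by apply/negP => /family_gen_translates[phi]; apply: ctx_inv_not_translation.
  rewrite -norm_joinEr //; apply/eqP; rewrite eqEsubset join_subG gen_subG sBG.
  rewrite cycle_subG Gp gen_subG; apply/subsetP => _ /imsetP[e + ->].
  rewrite inE => /sGA; rewrite -ctx_invM => eA.
  rewrite -[X in X \in _](mulgK p) groupM //.
    by apply: subsetP eA; apply: joing_subl.
  by rewrite groupV; apply: (subsetP (joing_subr _ _)); apply: cycle_id.
rewrite isog_cyclic_card ?cycle_cyclic // -orderE p2 cardsT card_ord eqxx andbT.
by apply: prime_cyclic; rewrite cardsT card_ord.
Qed.

End TriangularFamily.

(** * Membership of translations in a group, as an equivalence relation on indices *)

Section MembershipRelation.
Variables (n : nat) (G : {group {perm 'rV['Z_12]_n}}).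
Implicit Types i j l : 'I_n.
Local Open Scope group_scope.

Lemma ctx_transl_mem_refl i : ctx_transl i i \in G.
Proof. by rewrite ctx_transl_refl group1. Qed.

Lemma ctx_transl_mem_sym i j : ctx_transl i j \in G -> ctx_transl j i \in G.
Proof. by rewrite -ctx_transl_inv groupV. Qed.

Lemma ctx_transl_mem_trans i j l :
  ctx_transl i j \in G -> ctx_transl j l \in G -> ctx_transl i l \in G.
Proof. by move=> Gij Gjl; rewrite -(ctx_translM i j l) groupM. Qed.

(** For two inversions sharing the index [l], one of the two factors of [ctx_invM] is trivial. *)
Lemma ctx_inv_mem_transl i j l :
  ctx_inv l i \in G -> ctx_inv l j \in G -> ctx_transl i j \in G.
Proof.
by move=> Gi Gj; have := groupM Gi Gj; rewrite ctx_invM ctx_transl_refl mul1g.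
Qed.

End MembershipRelation.

(** * The group of all index differences and its bases *)

Lemma ctx_transl_setE n r (k j : 'I_r -> 'I_n) (P : rel nat) :
  (forall i, P (k i).+1 (j i).+1) ->
  (forall a b : 'I_n, P a.+1 b.+1 -> exists2 i, a = k i & b = j i) ->
  ctx_transl_set n P = [set ctx_transl (k i) (j i) | i : 'I_r].
Proof.
move=> Pkj Psub; apply/setP => g; apply/imsetP/imsetP => [[[a b]] | [i _ ->]].
  by rewrite inE /= => /Psub[i -> ->] ->; exists i.
by exists (k i, j i); rewrite ?inE ?Pkj.
Qed.

(** Generated by all pairs, hence independent of any basis, so that several bases can be compared
    within one group. *)
Definition full_transl_group n : {group {perm 'rV['Z_12]_n}} :=
  <<[set ctx_transl e.1 e.2 | e : 'I_n * 'I_n]>>%G.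

Lemma full_transl_mem n (i j : 'I_n) : ctx_transl i j \in full_transl_group n.
Proof. by rewrite mem_gen //; apply/imsetP; exists (i, j). Qed.

(** Attaching each nonzero index to a smaller one gives a tree rooted at 0. Following the tree down
    to the root writes every [ctx_transl a ord0] as a product of generators, and these quotients
    yield all pairs. *)
Lemma full_transl_groupE n (j : 'I_n -> 'I_n.+1) :
  (forall i, j i < lift ord0 i) ->
  full_transl_group n.+1 = <<[set ctx_transl (lift ord0 i) (j i) | i : 'I_n]>>%G.
Proof.
move=> lt_j; set A := (RHS); apply/val_inj/eqP; rewrite /= eqEsubset !gen_subG.
apply/andP; split; apply/subsetP => g /imsetP[]; last first.
  by move=> i _ ->; exact: full_transl_mem.
have A0 a : ctx_transl a ord0 \in A.
  have [m] := ubnP (val a); elim: m a => // m IHm a /=.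
  case: (unliftP ord0 a) => [i -> lt_im|-> _]; last exact: ctx_transl_mem_refl.
  apply: (ctx_transl_mem_trans (j := j i)); last first.
    by apply: IHm; apply: leq_trans (lt_j i) lt_im.
  by apply/mem_gen/imsetP; exists i.
move=> [a b] _ -> /=; apply: ctx_transl_mem_trans (A0 a) _.
exact: ctx_transl_mem_sym (A0 b).
Qed.

(** Here [f] describes the tree: the nonzero index [k], counted from 0, has parent [f k.-1], the
    shift coming from [lift ord0]. *)
Lemma full_Z12_basis n (f : nat -> nat) (P : rel nat) :
  (forall i, f i <= i) ->
  (forall k j, 0 < k <= n -> P k.+1 j.+1 = (j == f k.-1)) ->
  (forall j, P 1 j = false) ->
  Z12_basis (full_transl_group n.+1) (ctx_transl_set n.+1 P).
Proof.
move=> le_f PE P1; pose j (i : 'I_n) : 'I_n.+1 := inord (f i).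
have jE i : j i = f i :> nat.
  by rewrite inordK // ltnS (leq_trans (le_f i)) // ltnW.
have lt_j i : j i < lift ord0 i by rewrite jE lift0 ltnS.
rewrite (full_transl_groupE lt_j) (@ctx_transl_setE _ _ (lift ord0) j).
- exact: (family_Z12_basis (@lift_inj _ ord0) lt_j).
- by move=> i; rewrite lift0 PE /= ?ltn_ord ?jE.
move=> a b; case: (unliftP ord0 a) => [i ->|->]; last by rewrite P1.
rewrite lift0 PE /= ?ltn_ord // => /eqP bE; exists i => //.
by apply/val_inj; rewrite /= jE.
Qed.

(** Applies [family_sdprod] to the star centred at 0. Its condition on generators is automatic,
    since the full group contains every [ctx_transl]. *)
Lemma full_sdprod n (E : pred ('I_n.+2 * 'I_n.+2)) :
  let G := <<[set ctx_inv e.1 e.2 | e : 'I_n.+2 * 'I_n.+2 & E e]>>%G in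
  E (ord0, inord 1) -> (forall k, ctx_transl k ord0 \in G) ->
  Z2_sdprod_Z12 G (full_transl_group n.+2) n.+1.
Proof.
move=> G E01 GT.
have lt_j (i : 'I_n.+1) : (ord0 : 'I_n.+2) < lift ord0 i by rewrite lift0.
rewrite (full_transl_groupE lt_j).
apply: (family_sdprod (@lift_inj _ ord0) lt_j (i0 := ord0) (i1 := inord 1)) => //.
- by rewrite -val_eqE /= inordK.
- by apply/subsetP => _ /imsetP[i _ ->]; apply: GT.
move=> e _.
have := groupM (full_transl_mem e.1 ord0) (full_transl_mem e.2 (inord 1)).
by rewrite (full_transl_groupE lt_j).
Qed.

Lemma ctx_inv_group_transl n (k l : 'I_n.+3) :
  ctx_transl k l \in ctx_inv_group n.+3.
Proof.
have Ginv (a b : 'I_n.+3) : a != b -> ctx_inv a b \in ctx_inv_group n.+3.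
  rewrite -val_eqE neq_ltn => /orP[lt_ab | lt_ba].
    by rewrite mem_gen //; apply/imsetP; exists (a, b); rewrite ?inE.
  by rewrite ctx_invC mem_gen //; apply/imsetP; exists (b, a); rewrite ?inE.
(* With at least three indices some [i] avoids both [k] and [l], and the inversions pairing [i] with
   each of them multiply to the translation. *)
have [i /norP[ik il]] : exists i : 'I_n.+3, ~~ ((i == k) || (i == l)).
  apply/existsP; rewrite -negb_forall; apply/negP => /forallP kl.
  have /subset_leq_card : [set: 'I_n.+3] \subset [set k; l].
    by apply/subsetP => i _; rewrite !inE.
  by rewrite cardsT card_ord cards2; case: eqP.
by apply: (@ctx_inv_mem_transl _ _ _ _ i); apply: Ginv.
Qed.

(** * Inversions of cyclically consecutive indices *)

Section Cyclic.
Variable n : nat.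
Local Notation G := (cyc_ctx_inv_group n.+3).
Implicit Types a b : 'I_n.+3.

Lemma cyc_ctx_inv_succ a b : b = a.+1 :> nat -> ctx_inv a b \in G.
Proof.
move=> ab; rewrite mem_gen //; apply/imsetP; exists (a, b) => //.
by rewrite inE /= ab addn1 eqxx.
Qed.

Lemma cyc_ctx_inv_ends : ctx_inv ord0 ord_max \in G.
Proof.
rewrite mem_gen //; apply/imsetP; exists (ord0, ord_max) => //.
by rewrite inE /= eqxx ?orbT.
Qed.

(** The inversions at [a - 1, a] and [a - 1, a - 2] share an index, which links [a] to [a - 2];
    descending by twos ends at 0 or 1, that is, at [odd a]. *)
Lemma cyc_ctx_transl_parity a : ctx_transl a (inord (odd a)) \in G.
Proof.
have [m] := ubnP (val a); elim: m a => // m IHm a /= lt_am.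
have [a_le1 | a_gt1] := leqP a 1.
  rewrite (_ : inord _ = a) ?ctx_transl_mem_refl //.
  by case: a a_le1 {lt_am} => -[|[|//]] lt_a _; apply/val_inj; rewrite /= inordK.
have lt_a := ltn_ord a.
have b1E : (inord a.-1 : 'I_n.+3) = a.-1 :> nat by rewrite inordK //; lia.
have b2E : (inord a.-2 : 'I_n.+3) = a.-2 :> nat by rewrite inordK //; lia.
apply: (@ctx_transl_mem_trans _ _ _ (inord a.-2)).
  apply: (@ctx_inv_mem_transl _ _ _ _ (inord a.-1)).
    by apply: cyc_ctx_inv_succ; lia.
  by rewrite ctx_invC; apply: cyc_ctx_inv_succ; lia.
have -> : odd a = odd (inord a.-2 : 'I_n.+3) by rewrite b2E; lia.
by apply: IHm; rewrite /= b2E; lia.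
Qed.

Lemma cyc_ctx_transl_odd a : odd n.+3 -> ctx_transl a ord0 \in G.
Proof.
move=> n_odd.
have G10 : ctx_transl (inord 1) ord0 \in G.
  (* The last index shares inversions with both its predecessor [n.+1] and 0, so these two are
     linked. As [n.+1] is odd, this joins the classes of 0 and 1. *)
  have bE : (inord n.+1 : 'I_n.+3) = n.+1 :> nat by rewrite inordK.
  apply: (@ctx_transl_mem_trans _ _ _ (inord n.+1)).
    apply: ctx_transl_mem_sym; have := cyc_ctx_transl_parity (inord n.+1).
    by rewrite bE (_ : odd n.+1 = true) //; move: n_odd => /=; rewrite negbK.
  apply: (@ctx_inv_mem_transl _ _ _ _ ord_max); rewrite ctx_invC.
    by apply: cyc_ctx_inv_succ; rewrite bE.
  exact: cyc_ctx_inv_ends.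
apply: ctx_transl_mem_trans (cyc_ctx_transl_parity a) _.
case: (odd a) => //; rewrite (_ : inord _ = ord0) ?ctx_transl_mem_refl //.
by apply/val_inj; rewrite /= inordK.
Qed.

End Cyclic.

(** Each index from 2 on is attached to 0 or 1 according to parity. This forest has two roots,
    whence the rank [n.+1], two less than the number of indices. *)
Lemma cyc_even n (P : rel nat) :
  ~~ odd n.+3 ->
  (forall k j, P k.+1 j.+1 = (2 <= k <= n.+2) && (j == odd k)) ->
  exists A : {group {perm 'rV['Z_12]_n.+3}},
    Z2_sdprod_Z12 (cyc_ctx_inv_group n.+3) A n.+1 /\
    Z12_basis A (ctx_transl_set n.+3 P).
Proof.
move=> n_even PE; pose k (i : 'I_n.+1) : 'I_n.+3 := lift ord0 (lift ord0 i).
pose j (i : 'I_n.+1) : 'I_n.+3 := inord (odd i).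
have kE i : k i = i.+2 :> nat by rewrite /k !lift0.
have jE i : j i = odd i :> nat by rewrite inordK //; case: (odd i).
have lt_jk i : j i < k i by rewrite kE jE; case: (odd i).
have k_inj : injective k by move=> a b /lift_inj/lift_inj.
rewrite (@ctx_transl_setE _ _ k j).
- exists <<[set ctx_transl (k i) (j i) | i : 'I_n.+1]>>%G.
  split; last exact: family_Z12_basis.
  set A := <<_>>%G.
  have AT a : ctx_transl a (inord (odd a)) \in A.
    have [a_le1 | a_gt1] := leqP a 1.
      rewrite (_ : inord _ = a) ?ctx_transl_mem_refl //.
      by case: a a_le1 => -[|[|//]] lt_a _; apply/val_inj; rewrite /= inordK.
    have lt_a := ltn_ord a; have lt_a2 : a.-2 < n.+1 by lia.
    rewrite mem_gen //; apply/imsetP; exists (Ordinal lt_a2) => //.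
    have -> : k (Ordinal lt_a2) = a by apply/ord_inj; rewrite kE /=; lia.
    by congr ctx_transl; rewrite /j /=; congr inord; lia.
  have AT' (a b : 'I_n.+3) : odd a = odd b -> ctx_transl a b \in A.
    move=> ab; apply: ctx_transl_mem_trans (AT a) _.
    by rewrite ab; exact: ctx_transl_mem_sym (AT b).
  have i1E : (inord 1 : 'I_n.+3) = 1 :> nat by rewrite inordK.
  apply: (family_sdprod k_inj lt_jk (i0 := ord0) (i1 := inord 1)).
  + by rewrite -val_eqE /= i1E.
  + by rewrite /= i1E.
  + apply/subsetP => _ /imsetP[i _ ->]; have := cyc_ctx_transl_parity (k i).
    by rewrite kE /= negbK.
  move=> [a b] /=; rewrite addn1 !eqSS.
  move=> /orP[/eqP ba | /andP[/eqP a0 /eqP bE]].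
    (* Exactly one of [a] and [b] is even. If it is [b], the lower indices 0 and 1 are exchanged so
       that each factor stays within one parity class. *)
    have [a_odd | a_even] := boolP (odd a).
      have -> : (ctx_transl a ord0 * ctx_transl b (inord 1) =
                 ctx_transl a (inord 1) * ctx_transl b ord0)%g.
        by rewrite -!ctx_invM (ctx_invC ord0).
      by rewrite groupM //; apply: AT'; rewrite ?ba ?i1E /= ?a_odd.
    by rewrite groupM //; apply: AT'; rewrite ?ba ?i1E /= ?(negPf a_even).
  (* For the closing pair, the last index is odd because the number of indices is even, so it
     matches 1. *)
  rewrite groupM //; apply: AT'; rewrite ?a0 ?bE ?i1E //=.
  by move: n_even => /=; rewrite negbK.
- by move=> i; rewrite PE kE jE /= negbK eqxx andbT !ltnS -ltnS.
move=> a b; rewrite PE => /andP[/andP[a_gt1 le_an] /eqP bE].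
have lt_a2 : a.-2 < n.+1 by lia.
exists (Ordinal lt_a2); apply/ord_inj; rewrite ?kE ?jE /=; lia.
Qed.

Theorem proposition1 (n : nat) (hn : 3 <= n) :
  (exists A : {group {perm 'rV['Z_12]_n}},
     [/\ Z2_sdprod_Z12 (ctx_inv_group n) A (n - 1),
         Z12_basis A (ctx_transl_set n
           (fun k j => (2 <= k <= n) && (j == 1)))
       & Z12_basis A (ctx_transl_set n
           (fun k j => (k == 2) && (j == 1) || (3 <= k <= n) && (j == 2)))])
  /\
  (~~ odd n ->
   exists A : {group {perm 'rV['Z_12]_n}},
     Z2_sdprod_Z12 (cyc_ctx_inv_group n) A (n - 2) /\
     Z12_basis A (ctx_transl_set n
       (fun k j => (3 <= k <= n) && (j == if odd k then 1 else 2))))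
  /\
  (odd n ->
   exists A : {group {perm 'rV['Z_12]_n}},
     Z2_sdprod_Z12 (cyc_ctx_inv_group n) A (n - 1) /\
     Z12_basis A (ctx_transl_set n
       (fun k j => (k == 2) && (j == 1)
                   || (3 <= k <= n) && (j == if odd k then 1 else 2)))).
Proof.
case: n hn => [|[|[|m]]] // _; rewrite subn1 subn2 /=; split; last split.
- exists (full_transl_group m.+3); split.
  + apply: full_sdprod => [|k]; last exact: ctx_inv_group_transl.
    by rewrite /= inordK.
  + apply: (full_Z12_basis (f := fun=> 0)) => // k j /andP[k_gt0 k_le].
    by rewrite !ltnS k_gt0 k_le eqSS.
  (* Tree of the second basis: index 1 hangs from 0, all later ones from 1. *)
  apply: (full_Z12_basis (f := fun i => 0 < i)) => [[]|[|[|k]] j|j] //=.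
    by rewrite orbF.
  by rewrite !ltnS => ->.
- move=> n_even; apply: cyc_even => // k j.
  by rewrite !ltnS /=; case: (odd k); case: j => [|[]].
move=> n_odd; exists (full_transl_group m.+3); split.
  apply: full_sdprod => [|k]; last exact: cyc_ctx_transl_odd.
  by rewrite /= inordK.
(* Counted from 0, an index hangs from 0 or 1 by parity, except that 1 hangs from 0: this edge is
   [T^2_1], which joins the two classes. *)
apply: (full_Z12_basis (f := fun i => (0 < i) && odd i.+1))
  => [[|i]|[|[|k]] j|j] //=.
- by case: (~~ odd i).
- by rewrite orbF.
by rewrite !ltnS => ->; rewrite !negbK; case: (odd k); case: j => [|[]].
Qed.
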